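(* Let $d\ge2$ and $\beta>0$. Suppose that the external field $h=(h_x)_x$ satisfies: $(|h_x|)_x$ are i.i.d. (the signs may be dependent) and $\mathbb{P}_h(|h_x|\le K)<\frac1{40d}$ for some $K$ such that $$\rho=\frac{e^{2d\beta-K}}{e^{2d\beta-K}+e^{-2d\beta+K}}<\frac1{40d}.$$ Then there is $C>0$ such that the random field Ising model at inverse temperature $\beta$ with external field $h$ satisfies $\mathrm{SSM}(C)$.
   Context: $\mathbb{Z}^d$ carries nearest-neighbour adjacency; $h=(h_x)_{x\in\mathbb{Z}^d}$ is a random real external field with law $\mathbb{P}_h$ and expectation $\mathbb{E}_h$. For finite $B\subset\mathbb{Z}^d$ with exterior vertex boundary $\partial B$ and $\xi\in\{-1,+1\}^{\partial B}$, $\mu_B^\xi$ is the random field Ising measure on $\{-1,+1\}^B$ with boundary condition $\xi$: $$\mu_B^\xi(\sigma)\propto\exp\Big(\beta\sum_{(u,v)\in E(B)}\sigma_u\sigma_v+\beta\sum_{u\in B,\,v\in\partial B,\,u\sim v}\sigma_u\xi_v+\sum_{u\in B}h_u\sigma_u\Big).$$ $B_r(o)$ is the $\ell_\infty$-ball of radius $r$ around the origin $o$, $d(\cdot,\cdot)$ is the $\ell_\infty$ distance, $d_{\mathrm{TV}}$ the total variation distance. $\mathrm{SSM}(C)$: for every $r\ge1$, every box $B\in\{w+B_r(o):w\in\{-r+1,\dots,r-1\}^d\}$ and every $z\in\partial B$, $$\mathbb{E}_h\Big[\max_{\xi\in\{-1,+1\}^{\partial B\setminus\{z\}}}d_{\mathrm{TV}}\big(\mu_B^{\xi^+}(\sigma_o\in\cdot),\mu_B^{\xi^-}(\sigma_o\in\cdot)\big)\Big]\le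 Ce^{-d(o,z)/C},$$ where $\xi^+,\xi^-\in\{-1,+1\}^{\partial B}$ agree with $\xi$ on $\partial B\setminus\{z\}$ and equal $+1$, $-1$ at $z$ respectively. *)

(* Defs.v *)
From HB Require Import structures.
From mathcomp Require Import all_boot all_order all_algebra.
From mathcomp Require Import finmap zify.
From mathcomp Require Import all_classical all_reals all_analysis.

Set Implicit Arguments.
Unset Strict Implicit.
Unset Printing Implicit Defensive.

Import Order.TTheory GRing.Theory Num.Theory.

Local Open Scope fset_scope.
Local Open Scope ring_scope.

Notation lattice d := 'rV[int]_d.

Section Lattice.
Variable d : nat.
Implicit Types (x y u v w : lattice d) (B : {fset lattice d}).

Definition nbrs x : {fset lattice d} :=
  [fset x + delta_mx 0 i | i in 'I_d] `|` [fset x - delta_mx 0 i | i in 'I_d].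

Definition adj u v : bool := v \in nbrs u.

Definition bdry B : {fset lattice d} := (\bigcup_(u <- B) nbrs u) `\` B.

Definition dist x y : nat := (\max_(i < d) absz (x 0 i - y 0 i)%R)%N.

(* w + B_r(o), listed explicitly so as to be a finite set; see in_box. *)
Definition box w (r : nat) : {fset lattice d} :=
  let shift (k : {ffun 'I_d -> 'I_(2 * r).+1}) : lattice d :=
    \row_i ((k i : nat)%:Z - r%:Z) in
  [fset w + shift k | k in {: {ffun 'I_d -> 'I_(2 * r).+1}}].

Lemma in_box w r x : (x \in box w r) = (dist w x <= r)%N.
Proof.
apply/imfsetP/bigmax_leqP => /= [[k _ ->] i _ | H].
  by rewrite !mxE; move: (ltn_ord (k i)); move: (w 0 i) (nat_of_ord _); lia.
pose f (i : 'I_d) := absz (x 0 i - w 0 i + r%:Z).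
exists [ffun i => inord (f i)] => //; apply/rowP => i; rewrite !mxE ffunE.
by rewrite inordK /f; move: (H i isT); move: (x 0 i) (w 0 i); lia.
Qed.

Definition admissible (r : nat) w : Prop :=
  forall i, - r%:Z + 1 <= w 0 i <= r%:Z - 1.

Lemma origin_in_box r w : admissible r w -> (0 : lattice d) \in box w r.
Proof.
move=> Hw; rewrite in_box; apply/bigmax_leqP => i _.
by have := Hw i; rewrite mxE; move: (w 0 i); lia.
Qed.

End Lattice.

Section TotalVariation.
Variables (R : realType) (S : finType).

Definition dTV (p q : S -> R) : R :=
  \big[Num.max/0]_(A : {set S}) `| \sum_(s in A) p s - \sum_(s in A) q s |.

End TotalVariation.

Section RandomFieldIsing.
Variables (R : realType) (d : nat).

(* Spins are booleans: true stands for +1 and false for -1. *)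
Definition spin (b : bool) : R := if b then 1 else -1.

Section Gibbs.
Variables (beta : R) (h : lattice d -> R) (B : {fset lattice d}).
Variable xi : {ffun bdry B -> bool}.

(* The first double sum runs over ordered pairs, so that it counts each edge
   of E(B) twice. *)
Definition weight (sigma : {ffun B -> bool}) : R :=
  expR (beta * (2^-1 * \sum_(u : B) \sum_(v : B | adj (val u) (val v))
                         spin (sigma u) * spin (sigma v))
        + beta * (\sum_(u : B) \sum_(v : bdry B | adj (val u) (val v))
                         spin (sigma u) * spin (xi v))
        + \sum_(u : B) h (val u) * spin (sigma u)).

Definition gibbs (sigma : {ffun B -> bool}) : R :=
  weight sigma / \sum_(tau : {ffun B -> bool}) weight tau.

Definition spin_law (x : B) (s : bool) : R :=
  \sum_(sigma : {ffun B -> bool} | sigma x == s) gibbs sigma.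

End Gibbs.

(* The boundary condition equal to xi off z and to s at z. *)
Definition extend (B : {fset lattice d}) (z : lattice d)
    (xi : {ffun bdry B `\ z -> bool}) (s : bool) : {ffun bdry B -> bool} :=
  [ffun v => if insub (val v) is Some u then xi u else s].

Definition influence (beta : R) (h : lattice d -> R) (B : {fset lattice d})
    (x : B) (z : lattice d) : R :=
  \big[Num.max/0]_(xi : {ffun bdry B `\ z -> bool})
    dTV (spin_law beta h (extend xi true) x)
        (spin_law beta h (extend xi false) x).

Definition rho (beta K : R) : R :=
  expR (2 * d%:R * beta - K)
  / (expR (2 * d%:R * beta - K) + expR (- (2 * d%:R * beta) + K)).

Section RandomField.
Context {disp : measure_display} {T : measurableType disp}.
Variable P : probability T R.

Definition SSM (beta : R) (h : lattice d -> T -> R) (C : R) : Prop :=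
  forall (r : nat) (w : lattice d) (hw : admissible r w) (z : lattice d),
    (1 <= r)%N -> z \in bdry (box w r) ->
    ('E_P[(fun t => influence beta (h^~ t) [` origin_in_box hw] z)]
     <= (C * expR (- (dist 0 z)%:R / C))%:E)%E.

End RandomField.
End RandomFieldIsing.

Section IID.
Context {R : realType} {disp : measure_display} {T : measurableType disp}.
Variables (P : probability T R) (I : choiceType).

Definition mutually_independent (X : I -> T -> R) : Prop :=
  forall (J : {fset I}) (A : I -> set R), (forall i, measurable (A i)) ->
    P [set t | forall i, i \in J -> A i (X i t)]%classic
    = (\prod_(i <- J) fine (P (X i @^-1` A i)%classic))%:E.

Definition identically_distributed (X : I -> T -> R) : Prop :=
  forall (i j : I) (A : set R), measurable A ->
    P (X i @^-1` A)%classic = P (X j @^-1` A)%classic.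

Definition iid (X : I -> T -> R) : Prop :=
  mutually_independent X /\ identically_distributed X.

End IID.

(* Main.v *)
Require Import Defs.
From HB Require Import structures.
From mathcomp Require Import all_boot all_order all_algebra.
From mathcomp Require Import finmap ring lra zify.
From mathcomp Require Import all_classical all_reals all_analysis.
From mathcomp Require Import measurable_realfun.

Import Order.TTheory GRing.Theory Num.Theory.

Set Implicit Arguments.
Unset Strict Implicit.
Unset Printing Implicit Defensive.

Local Open Scope ring_scope.

(** Changing the boundary spin at [z] changes the field at the neighbours of
    [z], so the question is how far such a change of field is felt at the
    origin.  It is followed through the log-odds of a spin, in the manner of
    the self-avoiding-walk recursion of Weitz, so that no coupling of
    configurations is needed.

    Condition on the spin at [y].  What remains is the Ising model on [A :\ y],
    whose field is shifted by [+ beta] or by [- beta] at all neighbours of [y]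
    at once.  Passing from one shift to the other one neighbour at a time
    ([flip_response_cons]) writes the log-odds at [y] as [2 * g y] plus a sum,
    over the neighbours [v] of [y], of a function [edge_map] of the log-odds of
    [v] in [A :\ y] ([logodds_rec], [flip_response1]).

    The function [edge_map] is a contraction wherever its argument is large:
    its Lipschitz constant is at most 1, and at most
    [kappa = expR (4 * d * beta - 2 * K)] at every vertex with [K < `|h v|],
    since there the log-odds are of order [2 * h v], whatever the other spins
    do ([edge_map_contract], [logodds_near_field]).  The assumption on [rho]
    says that [kappa < 2 / (40 * d)] ([kappa_lt]).  Iterating the recursion
    bounds the effect of [z] on the origin by a sum over self-avoiding walks
    from the origin to [z] of the product of the costs [kappa + \1_(bad v)] of
    the vertices met ([logodds_diff], [influence_le]).

    Only the moduli of the fields enter these costs, and a self-avoiding walk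
    meets each vertex once, so by independence the expected product along a
    walk of length [n] is at most [(3 / (40 * d)) ^+ n].  There are at most
    [(2 * d) ^+ n] walks of length [n], and the sum decays geometrically.
    The expectation is taken along the recursion
    itself ([integral_saw_bound]), and the geometric decay appears as a
    supersolution [m] proportional to [2^-1 ^+ dist v z]. *)

(** * The single-edge map *)

Section Psi.
Variable R : realType.
Implicit Types t k L : R.

(** With [t = expR (2 * beta)], [expR (edge_map t L)] is the ratio of the
    expectations of [expR (beta * s)] and [expR (- beta * s)] for a spin [s]
    with log-odds [L], that is, what a neighbour joined to [s] by an edge sees
    of it. *)
Definition edge_map t L : R := ln (t * expR L + 1) - ln (expR L + t).

Lemma ln_diff_le (x y : R) k : 0 < x -> 0 < y -> y <= expR k * x ->
  ln y - ln x <= k.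
Proof.
move=> x0 y0 yx; rewrite lerBlDr.
have -> : k + ln x = ln (expR k * x) by rewrite lnM ?posrE ?expR_gt0// expRK.
by rewrite ler_ln// posrE mulr_gt0 ?expR_gt0.
Qed.

Lemma edge_mapN t L : 0 < t -> edge_map t (- L) = - edge_map t L.
Proof.
move=> t0; have e0 := expR_gt0 L; rewrite /edge_map expRN.
have -> : t * (expR L)^-1 + 1 = (expR L + t) * (expR L)^-1.
  by field; rewrite gt_eqF.
have -> : (expR L)^-1 + t = (t * expR L + 1) * (expR L)^-1.
  by field; rewrite gt_eqF.
have te : 0 < t * expR L by rewrite mulr_gt0.
rewrite !lnM ?posrE ?invr_gt0//; first ring; lra.
Qed.

Lemma edge_map_le t L : 1 <= t -> edge_map t L <= ln t.
Proof.
move=> t1; have e0 := expR_gt0 L; have t0 : 0 < t by lra.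
by apply: ln_diff_le; rewrite ?lnK ?posrE//; nra.
Qed.

Lemma edge_map_abs t L : 1 <= t -> `|edge_map t L| <= ln t.
Proof.
move=> t1; rewrite ler_norml edge_map_le// andbT -lerN2 opprK.
by rewrite -edge_mapN ?edge_map_le//; lra.
Qed.

Lemma edge_map_homo t : 1 <= t -> {homo edge_map t : x y / x <= y}.
Proof.
move=> t1 x y xy; have x0 := expR_gt0 x; have y0 := expR_gt0 y.
have exy : expR x <= expR y by rewrite ler_expR.
have t0 : 0 < t by lra.
have tx : 0 < t * expR x by rewrite mulr_gt0.
have ty : 0 < t * expR y by rewrite mulr_gt0.
rewrite /edge_map lerBlDr addrAC lerBrDr -!lnM ?posrE; try lra.
rewrite ler_ln ?posrE ?mulr_gt0; try lra.
have : 0 <= (t * t - 1) * (expR y - expR x) by rewrite mulr_ge0; nra.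
lra.
Qed.

Lemma edge_map_nonexp t x y : 1 <= t -> x <= y ->
  edge_map t y - edge_map t x <= y - x.
Proof.
move=> t1 xy; have x0 := expR_gt0 x; have y0 := expR_gt0 y.
have exy : expR x <= expR y by rewrite ler_expR.
have t0 : 0 < t by lra.
have tx : 0 < t * expR x by rewrite mulr_gt0.
have ty : 0 < t * expR y by rewrite mulr_gt0.
have ee : expR y = expR (y - x) * expR x by rewrite -expRD subrK.
have e1 : 1 <= expR (y - x) by rewrite -expR0 ler_expR; lra.
have H1 : ln (t * expR y + 1) - ln (t * expR x + 1) <= y - x.
  by apply: ln_diff_le; nra.
have H2 : ln (expR x + t) <= ln (expR y + t) by rewrite ler_ln ?posrE; lra.
rewrite /edge_map; lra.
Qed.

(** For very negative arguments both terms of [edge_map] are nearly constant: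
    the derivative of [ln (t * expR x + 1)] is at most [t * expR x]. *)
Lemma edge_map_contract_neg t k x y : 1 <= t -> x <= y -> t * expR y <= k ->
  edge_map t y - edge_map t x <= k * (y - x).
Proof.
move=> t1 xy yk; have x0 := expR_gt0 x; have y0 := expR_gt0 y.
have exy : expR x <= expR y by rewrite ler_expR.
have t0 : 0 < t by lra.
have tx : 0 < t * expR x by rewrite mulr_gt0.
have ty : 0 < t * expR y by rewrite mulr_gt0.
have H1 : ln (t * expR y + 1) - ln (t * expR x + 1) <= k * (y - x).
  have ee : expR x = expR (x - y) * expR y by rewrite -expRD subrK.
  have e1 : 1 + (x - y) <= expR (x - y) by exact: expR_ge1Dx.
  have e2 : 1 + k * (y - x) <= expR (k * (y - x)) by exact: expR_ge1Dx.
  apply: ln_diff_le; try lra.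
  set a := expR x in x0 tx ee exy *; set b := expR y in y0 ty yk ee exy *.
  have A : t * b - t * a <= k * (y - x).
    apply: (@le_trans _ _ (t * b * (y - x))); last by apply: ler_wpM2r; lra.
    by rewrite ee -subr_ge0 (_ : _ - _ = t * b * (expR (x - y) - (1 + (x - y))));
       [rewrite mulr_ge0; lra|ring].
  have k0 : 0 <= k * (y - x) by rewrite mulr_ge0; nra.
  nra.
have H2 : ln (expR x + t) <= ln (expR y + t) by rewrite ler_ln ?posrE; lra.
rewrite /edge_map; lra.
Qed.

Lemma edge_map_lip t x y : 1 <= t -> `|edge_map t y - edge_map t x| <= `|y - x|.
Proof.
move=> t1; wlog xy : x y / x <= y.
  move=> W; case: (leP x y) => [|/ltW] xy; first exact: W.
  by rewrite distrC (distrC y); apply: W.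
have := edge_map_nonexp t1 xy; have := edge_map_homo t1 xy => *.
by rewrite !ger0_norm//; lra.
Qed.

(** Both arguments have to be large with the same sign: the map is not a strong
    contraction around 0.  The positive side follows because the map is odd. *)
Lemma edge_map_contract t k x y : 1 <= t ->
  (t * expR x <= k /\ t * expR y <= k) \/
  (t * expR (- x) <= k /\ t * expR (- y) <= k) ->
  `|edge_map t y - edge_map t x| <= k * `|y - x|.
Proof.
move=> t1; wlog xy : x y / x <= y.
  move=> W; case: (leP x y) => [|/ltW] xy; first exact: W.
  by rewrite distrC (distrC y) => H; apply: W => //; tauto.
have := edge_map_homo t1 xy => P.
rewrite !ger0_norm; try lra.
case=> -[H1 H2]; first exact: edge_map_contract_neg.
have nxy : - y <= - x by lra.
have := edge_map_contract_neg t1 nxy H1.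
rewrite !edge_mapN; lra.
Qed.

End Psi.

(** * The recursion for the log-odds *)

(** The sum over the self-avoiding walks of [A] from [y] of the costs [c] of the
    vertices after [y], times [a] at the end point.  Removing [y] from [A] is
    what makes the walks self-avoiding, and thereby the costs independent.  The
    number [n] is fuel, harmless as soon as [#|A| <= n]. *)
Fixpoint saw_bound (R : realType) (V : finType) (e : rel V) (a c : V -> R)
    (n : nat) (A : {set V}) (y : V) : R :=
  if n is n'.+1 then
    a y + \sum_(v in A :\ y | e y v) c v * saw_bound e a c n' (A :\ y) v
  else 0.

Lemma saw_bound_ge0 (R : realType) (V : finType) (e : rel V)
    (a c : V -> R) n A y :
  (forall v, 0 <= a v) -> (forall v, 0 <= c v) ->
  0 <= saw_bound e a c n A y.
Proof.
move=> a0 c0; elim: n A y => //= n IH A y.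
by rewrite addr_ge0// sumr_ge0// => v _; rewrite mulr_ge0.
Qed.

Section Ising.
Variables (R : realType) (V : finType) (e : rel V) (beta : R).
Hypotheses (e_sym : symmetric e) (e_irr : irreflexive e).
Implicit Types (A : {set V}) (g : V -> R) (y v : V) (s : seq V).
Implicit Types sigma : {ffun V -> bool}.

(** The spins outside [A] do not interact, but the configurations range over all
    of [V]: this multiplies partition functions by a power of 2, which cancels
    in every ratio, and it makes vertex removal an operation on [A] alone.
    Boundary conditions are absorbed in the field [g]. *)
Definition energy A g sigma : R :=
  beta * (2^-1 * \sum_(u in A) \sum_(v in A | e u v)
                   spin R (sigma u) * spin R (sigma v))
  + \sum_(u in A) g u * spin R (sigma u).

Definition partition_fun A g : R :=
  \sum_(sigma : {ffun V -> bool}) expR (energy A g sigma).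

Definition pinned_partition A g y b : R :=
  \sum_(sigma : {ffun V -> bool} | sigma y == b) expR (energy A g sigma).

Definition logodds A g y : R :=
  ln (pinned_partition A g y true) - ln (pinned_partition A g y false).

Definition kick g (eps : R) s : V -> R := fun u => g u + eps * (u \in s)%:R.

Definition flip_response A g s : R :=
  ln (partition_fun A (kick g beta s))
  - ln (partition_fun A (kick g (- beta) s)).

Lemma energy_local A g g' sigma sigma' :
  {in A, g =1 g'} -> {in A, sigma =1 sigma'} ->
  energy A g sigma = energy A g' sigma'.
Proof.
move=> gg ss; rewrite /energy; congr (beta * (2^-1 * _) + _).
  apply: eq_bigr => u uA; apply: eq_bigr => v /andP[vA _].
  by rewrite !ss.
by apply: eq_bigr => u uA; rewrite gg// ss.
Qed.

Lemma partition_fun_local A g g' : {in A, g =1 g'} ->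
  partition_fun A g = partition_fun A g'.
Proof.
by move=> gg; apply: eq_bigr => sigma _; congr expR; exact: energy_local.
Qed.

Lemma partition_fun_gt0 A g : 0 < partition_fun A g.
Proof.
rewrite /partition_fun (bigD1 [ffun=> true])//= ltr_pwDl ?expR_gt0//.
by rewrite sumr_ge0 => // *; exact: expR_ge0.
Qed.

Lemma pinned_partition_gt0 A g y b : 0 < pinned_partition A g y b.
Proof.
rewrite /pinned_partition (bigD1 [ffun=> b])/= ?ffunE// ltr_pwDl ?expR_gt0//.
by rewrite sumr_ge0 => // *; exact: expR_ge0.
Qed.

Lemma partition_fun_split A g y :
  partition_fun A g =
  pinned_partition A g y true + pinned_partition A g y false.
Proof.
rewrite /partition_fun (bigID (fun sigma => sigma y == true))/=; congr (_ + _).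
by apply: eq_bigl => sigma; case: (sigma y).
Qed.

Definition flip y sigma : {ffun V -> bool} :=
  [ffun u => if u == y then ~~ sigma u else sigma u].

Lemma flipK y : involutive (flip y).
Proof.
move=> sigma; apply/ffunP => u; rewrite !ffunE.
by case: eqP => // ->; rewrite negbK.
Qed.

Lemma sum_fixed_spin (F : {ffun V -> bool} -> R) y b :
  (forall sigma, F (flip y sigma) = F sigma) ->
  \sum_(sigma : {ffun V -> bool} | sigma y == b) F sigma
  = 2^-1 * \sum_(sigma : {ffun V -> bool}) F sigma.
Proof.
move=> FF; rewrite [in RHS](bigID (fun sigma => sigma y == b))/=.
have -> : \sum_(sigma : {ffun V -> bool} | sigma y != b) F sigma
        = \sum_(sigma : {ffun V -> bool} | sigma y == b) F sigma.
  rewrite (reindex_inj (inv_inj (flipK y)))/=.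
  apply: eq_big => [sigma|sigma _] //.
  by rewrite ffunE eqxx; case: (sigma y) b => -[].
lra.
Qed.

Lemma energy_remove A g y b sigma : y \in A -> sigma y = b ->
  energy A g sigma =
  spin R b * g y
  + energy (A :\ y) (fun u => g u + beta * spin R b * (e y u)%:R) sigma.
Proof.
move=> yA sy; rewrite /energy.
have S (F : V -> R) : \sum_(u in A) F u = F y + \sum_(u in A :\ y) F u.
  rewrite (bigD1 y)//=; congr (_ + _).
  by apply: eq_bigl => u; rewrite in_setD1 andbC.
pose G u v := (e u v)%:R * (spin R (sigma u) * spin R (sigma v)).
have Sc B u : \sum_(v in B | e u v) spin R (sigma u) * spin R (sigma v)
            = \sum_(v in B) G u v.
  rewrite big_mkcondr/=; apply: eq_bigr => v _.
  by rewrite /G; case: (e u v); rewrite ?mul1r ?mul0r.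
under eq_bigr do rewrite Sc.
under [in RHS]eq_bigr do rewrite Sc.
rewrite !S {1}/G e_irr mul0r add0r sy.
have -> : \sum_(u in A :\ y) \sum_(v in A) G u v
  = \sum_(u in A :\ y) G u y + \sum_(u in A :\ y) \sum_(v in A :\ y) G u v.
  by rewrite -big_split; apply: eq_bigr => u _; rewrite S.
under [X in _ = _ + (_ + X)]eq_bigr do rewrite mulrDl.
rewrite [X in _ = _ + (_ + X)]big_split/=.
have -> : \sum_(u in A :\ y) G u y = \sum_(u in A :\ y) G y u.
  by apply: eq_bigr => u _; rewrite /G e_sym; ring.
have -> : \sum_(u in A :\ y) beta * spin R b * (e y u)%:R * spin R (sigma u)
        = beta * \sum_(u in A :\ y) G y u.
  by rewrite mulr_sumr; apply: eq_bigr => u _; rewrite /G sy; ring.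
lra.
Qed.

(** Pinning the spin at [y] to [b] turns its edges into a field on its
    neighbours; the factor [2^-1] is the free spin left at [y]. *)
Lemma pinned_partition_rec A g y b : y \in A ->
  pinned_partition A g y b = 2^-1 * expR (spin R b * g y)
     * partition_fun (A :\ y) (fun u => g u + beta * spin R b * (e y u)%:R).
Proof.
move=> yA; rewrite /pinned_partition.
under eq_bigr => sigma /eqP sy do rewrite (energy_remove _ yA sy) expRD.
rewrite -mulr_sumr sum_fixed_spin; first by rewrite /partition_fun; ring.
move=> sigma; congr expR; apply: energy_local => // u.
by rewrite in_setD1 ffunE => /andP[/negbTE -> _].
Qed.

Definition nbr_seq A y : seq V := enum [set v in A | e y v].

Lemma mem_nbr_seq A y v : (v \in nbr_seq A y) = (v \in A) && e y v.
Proof. by rewrite mem_enum inE. Qed.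

Lemma logodds_rec A g y : y \in A ->
  logodds A g y = 2 * g y + flip_response (A :\ y) g (nbr_seq (A :\ y) y).
Proof.
move=> yA; rewrite /logodds /flip_response !pinned_partition_rec// /spin.
have E eps : partition_fun (A :\ y) (fun u => g u + beta * eps * (e y u)%:R)
           = partition_fun (A :\ y) (kick g (beta * eps) (nbr_seq (A :\ y) y)).
  by apply: partition_fun_local => u uA; rewrite /kick mem_nbr_seq uA.
rewrite !E mulr1 mulrN1 mul1r mulN1r.
have P := partition_fun_gt0 (A :\ y).
have X x : 0 < expR x :> R := expR_gt0 x.
rewrite !lnM ?posrE ?mulr_gt0//; rewrite ?invr_gt0//.
rewrite !expRK; lra.
Qed.

Lemma partition_fun_kick1 A g y eps : y \in A ->
  partition_fun A (kick g eps [:: y]) =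
  expR eps * pinned_partition A g y true
  + expR (- eps) * pinned_partition A g y false.
Proof.
move=> yA.
have E b : pinned_partition A (kick g eps [:: y]) y b
         = expR (spin R b * eps) * pinned_partition A g y b.
  rewrite !pinned_partition_rec// /kick inE eqxx mulr1 mulrDr expRD.
  set z := partition_fun _ _; set z' := partition_fun _ _.
  suff -> : z = z' by ring.
  apply: partition_fun_local => u; rewrite !inE => /andP[/negbTE -> _].
  by rewrite mulr0 addr0.
by rewrite (partition_fun_split _ _ y) !E /spin mul1r mulN1r.
Qed.

Lemma flip_response1 A g y : y \in A ->
  flip_response A g [:: y] = edge_map (expR (2 * beta)) (logodds A g y).
Proof.
move=> yA; rewrite /flip_response !partition_fun_kick1// /edge_map /logodds.
rewrite opprK.
have a0 := pinned_partition_gt0 A g y true.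
have b0 := pinned_partition_gt0 A g y false.
move: (pinned_partition A g y true) (pinned_partition A g y false) a0 b0.
move=> a b a0 b0.
have X x : 0 < expR x :> R := expR_gt0 x.
have -> : expR (ln a - ln b) = a / b by rewrite expRD expRN !lnK ?posrE.
set t := expR beta.
have -> : expR (- beta) = t^-1 by rewrite expRN.
have -> : expR (2 * beta) = t * t by rewrite -expRD; congr expR; ring.
have t0 : 0 < t := X _.
have -> : t * a + t^-1 * b = (t * t * (a / b) + 1) * (b / t).
  by field; rewrite !gt_eqF.
have -> : t^-1 * a + t * b = ((a / b) + t * t) * (b / t).
  by field; rewrite !gt_eqF.
have ? : 0 < a / b by rewrite divr_gt0.
have k0 : 0 < b / t by rewrite divr_gt0.
have L (p : R) : 0 < p -> ln (p * (b / t)) = ln p + ln (b / t).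
  by move=> p0; apply: lnM; rewrite posrE.
by rewrite !L ?addr_gt0 ?mulr_gt0 ?invr_gt0//; ring.
Qed.

Lemma kick_cat g eps y s : y \notin s ->
  kick g eps (y :: s) = kick (kick g eps [:: y]) eps s.
Proof.
move=> ys; apply/funext => u; rewrite /kick !inE.
by case: eqP => [->|_]; rewrite ?(negbTE ys) /= ?mulr0 ?addr0.
Qed.

Lemma kickC g eps eps' s s' :
  kick (kick g eps s) eps' s' = kick (kick g eps' s') eps s.
Proof. by apply/funext => u; rewrite /kick addrAC. Qed.

(** The telescoping step: [y] is flipped first, while [s] is still negative, and
    then [s] with [y] already positive.  Thus each neighbour sees the other ones
    in a fixed state when its own field is switched. *)
Lemma flip_response_cons A g y s : y \notin s ->
  flip_response A g (y :: s) =
  flip_response A (kick g beta [:: y]) s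
  + flip_response A (kick g (- beta) s) [:: y].
Proof.
move=> ys; rewrite /flip_response.
have -> : kick g beta (y :: s) = kick (kick g beta [:: y]) beta s.
  exact: kick_cat.
have -> : kick g (- beta) (y :: s) = kick (kick g (- beta) s) (- beta) [:: y].
  by rewrite kick_cat// [LHS]kickC.
have -> : kick (kick g (- beta) s) beta [:: y]
        = kick (kick g beta [:: y]) (- beta) s.
  exact: kickC.
by rewrite addrA subrK.
Qed.

Hypothesis beta0 : 0 <= beta.

Lemma expR2beta_ge1 : 1 <= expR (2 * beta).
Proof. by rewrite -expR0 ler_expR mulr_ge0. Qed.

Lemma flip_response_le A g s : uniq s -> {subset s <= A} ->
  `|flip_response A g s| <= 2 * beta * (size s)%:R.
Proof.
elim: s g => [|y s IH] g /=.
  move=> _ _; rewrite mulr0 normr_le0; apply/eqP.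
  have E eps : kick g eps [::] = g.
    by apply/funext => u; rewrite /kick mulr0 addr0.
  by rewrite /flip_response !E subrr.
case/andP=> ys us sub; rewrite flip_response_cons//.
apply: (le_trans (ler_normD _ _)).
have yA : y \in A by apply: sub; rewrite inE eqxx.
have sub' : {subset s <= A} by move=> v vs; apply: sub; rewrite inE vs orbT.
have H1 := IH (kick g beta [:: y]) us sub'.
have H2 := edge_map_abs (logodds A (kick g (- beta) s) y) expR2beta_ge1.
rewrite expRK -flip_response1// in H2.
by rewrite -natr1; lra.
Qed.

(** Along the telescoping, the fields [g'] under which a vertex [v] of [s] is
    switched differ from [g] only at the other vertices of [s], and by at most
    [beta]; that [g' v = g v] is what saves one [beta] in the estimate at [v],
    see [logodds_near_field]. *)
Lemma flip_response_diff A g (delta w : V -> R) s : uniq s ->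
  (forall g' v, v \in s -> (forall u, u \notin s -> g' u = g u) ->
     g' v = g v -> (forall u, `|g' u - g u| <= beta) ->
     `|flip_response A (g' \+ delta) [:: v] - flip_response A g' [:: v]|
     <= w v) ->
  `|flip_response A (g \+ delta) s - flip_response A g s| <= \sum_(v <- s) w v.
Proof.
elim: s g => [|y s IH] g /=.
  move=> _ _; rewrite big_nil normr_le0 /flip_response.
  have E g' eps : kick g' eps [::] = g'.
    by apply/funext => u; rewrite /kick mulr0 addr0.
  by rewrite !E !subrr.
case/andP=> ys us H.
have Ec g1 : flip_response A g1 (y :: s) = _ := flip_response_cons A g1 ys.
rewrite !Ec big_cons opprD addrACA addrC.
apply: (le_trans (ler_normD _ _)).
have kD eps s' : kick (g \+ delta) eps s' = kick g eps s' \+ delta.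
  by apply/funext => u; rewrite /kick/= addrAC.
have b1 (b : bool) : beta * b%:R <= beta by case: b; rewrite /= ?mulr1 ?mulr0.
have b2 (b : bool) : 0 <= beta * b%:R by case: b; rewrite /= ?mulr1 ?mulr0.
rewrite !kD; apply: lerD.
  apply: H; rewrite ?inE ?eqxx//.
  - move=> u; rewrite inE negb_or => /andP[_ /negbTE us'].
    by rewrite /kick us' mulr0 addr0.
  - by rewrite /kick (negbTE ys) mulr0 addr0.
  - move=> u; rewrite /kick addrAC subrr add0r mulNr normrN ger0_norm//.
apply: IH => // g' v vs E1 E2 E3.
have vy : v != y by apply: contraNneq ys => <-.
apply: H => //.
- by rewrite inE vs orbT.
- move=> u; rewrite inE negb_or => /andP[uy us'].
  by rewrite E1// /kick inE (negbTE uy) mulr0 addr0.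
- by rewrite E2 /kick inE (negbTE vy) mulr0 addr0.
move=> u; have [us'|us'] := boolP (u \in s).
  have := E3 u; rewrite /kick inE (_ : u == y = false) ?mulr0 ?addr0//.
  by apply: contraNF ys => /eqP <-.
by rewrite E1// /kick addrAC subrr add0r ger0_norm.
Qed.

Definition deg A u : nat := #|[set v in A | e u v]|.

Lemma size_nbr_seq A y : size (nbr_seq A y) = deg A y.
Proof. by rewrite /nbr_seq -cardE. Qed.

Lemma deg_remove A y u : y \in A -> e u y -> deg A u = (deg (A :\ y) u).+1.
Proof.
move=> yA uy; rewrite /deg (cardsD1 y) inE yA uy add1n; congr S.
by apply: eq_card => v; rewrite !inE andbA.
Qed.

Lemma deg_mono A y u : (deg (A :\ y) u <= deg A u)%N.
Proof.
apply: subset_leq_card; apply/fintype.subsetP => v; rewrite !inE.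
by case/andP=> /andP[_ -> ->].
Qed.

Section Comparison.
Variables (h : V -> R) (D K : R) (delta a c : V -> R).

(** Every edge from [u] that has been cut has moved the field at [u] by at most
    [beta], and the remaining ones can still do so.  This is preserved by vertex
    removal, with [D = 2 * d * beta] at the start. *)
Definition boundary_room A g :=
  forall u, u \in A -> `|g u - h u| + beta * (deg A u)%:R <= D.

Lemma boundary_room_remove A y g g' : y \in A -> boundary_room A g ->
  (forall u, u \notin nbr_seq (A :\ y) y -> g' u = g u) ->
  (forall u, `|g' u - g u| <= beta) -> boundary_room (A :\ y) g'.
Proof.
move=> yA cg E1 E2 u uA; have uA' : u \in A by case/setD1P: uA.
have := cg u uA'; have [yu|yu] := boolP (e y u).
  rewrite (deg_remove yA) 1?e_sym// -natr1.
  have := E2 u; have := ler_normD (g' u - g u) (g u - h u); rewrite addrA subrK.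
  lra.
rewrite E1 ?mem_nbr_seq ?uA//=; apply: le_trans; rewrite lerD2l.
by rewrite ler_wpM2l// ler_nat deg_mono.
Qed.

Hypothesis a_delta : forall u, 2 * `|delta u| <= a u.
Hypothesis c1 : forall u, `|h u| <= K -> 1 <= c u.
Hypothesis ck : forall u, expR (2 * D - 2 * K) <= c u.

(** The edge to the removed vertex from which [v] is reached contributes neither
    to the field nor to the degree, hence [D - beta] in place of [D].  This
    [beta] compensates the factor [expR (2 * beta)] in [edge_map_contract]. *)
Lemma logodds_near_field A v g : v \in A ->
  `|g v - h v| + beta * (deg A v)%:R <= D - beta ->
  `|logodds A g v - 2 * h v| <= 2 * (D - beta).
Proof.
move=> vA cg; rewrite logodds_rec//.
have := @flip_response_le (A :\ v) g (nbr_seq (A :\ v) v).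
rewrite enum_uniq size_nbr_seq => /(_ isT).
have /[swap]/[apply] : {subset nbr_seq (A :\ v) v <= A :\ v}.
  by move=> u; rewrite mem_nbr_seq => /andP[].
have : beta * (deg (A :\ v) v)%:R <= beta * (deg A v)%:R.
  by rewrite ler_wpM2l// ler_nat deg_mono.
set x := flip_response _ _ _ => H1 H2.
have -> : 2 * g v + x - 2 * h v = 2 * (g v - h v) + x by ring.
apply: (le_trans (ler_normD _ _)); rewrite normrM ger0_norm//; lra.
Qed.

(** When [K < `|h v|], both log-odds exceed [2 * K - 2 * (D - beta)] in the
    direction of the sign of [h v]; otherwise [edge_map] is merely
    nonexpansive. *)
Lemma flip_response_contract A v g g' : v \in A ->
  `|g v - h v| + beta * (deg A v)%:R <= D - beta ->
  `|g' v - h v| + beta * (deg A v)%:R <= D - beta ->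
  `|flip_response A g' [:: v] - flip_response A g [:: v]| <=
    c v * `|logodds A g' v - logodds A g v|.
Proof.
move=> vA cg cg'; rewrite !flip_response1//.
have [hK|hK] := leP `|h v| K.
  apply: (le_trans (edge_map_lip _ _ expR2beta_ge1)).
  by rewrite ler_peMl// c1.
have l := logodds_near_field vA cg; rewrite ler_norml in l.
have l' := logodds_near_field vA cg'; rewrite ler_norml in l'.
case/andP: l => l1 l2; case/andP: l' => l3 l4.
have ckv := ck v.
apply: (edge_map_contract expR2beta_ge1).
rewrite -!expRD; move: hK; rewrite ltr_normr => /orP[] hK; [right|left].
- by split; apply: le_trans ckv; rewrite ler_expR; lra.
- by split; apply: le_trans ckv; rewrite ler_expR; lra.
Qed.

(** The field [delta] acts directly on the log-odds at [y], through
    [2 * delta y], and through each neighbour [v], by the change of the log-odds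
    at [v] in [A :\ y], contracted by [c v]. *)
Lemma logodds_diff n A y g : (#|A| <= n)%N -> y \in A ->
  boundary_room A g -> boundary_room A (g \+ delta) ->
  `|logodds A (g \+ delta) y - logodds A g y| <= saw_bound e a c n A y.
Proof.
elim: n A y g => [|n IH] A y g /=.
  by rewrite leqn0 cards_eq0 => /eqP ->; rewrite inE.
move=> cA yA cg cgd; rewrite !logodds_rec//=.
set s := nbr_seq _ _; set A' := A :\ y.
have -> : 2 * (g y + delta y) + flip_response A' (g \+ delta) s
     - (2 * g y + flip_response A' g s)
   = 2 * delta y + (flip_response A' (g \+ delta) s - flip_response A' g s) by ring.
apply: (le_trans (ler_normD _ _)); apply: lerD.
  by rewrite normrM ger0_norm.
have -> : \sum_(v in A' | e y v) c v * saw_bound e a c n A' v =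
   \sum_(v <- s) c v * saw_bound e a c n A' v.
  by rewrite big_enum; apply: eq_bigl => v; rewrite inE.
apply: flip_response_diff => [|g' v vs E1 E2 E3]; first exact: enum_uniq.
have := vs; rewrite mem_nbr_seq -/A' => /andP[vA' yv].
have vA : v \in A by case/setD1P: vA'.
have cg' : boundary_room A' g' by apply: boundary_room_remove yA cg E1 E3.
have cgd' : boundary_room A' (g' \+ delta).
  apply: boundary_room_remove yA cgd _ _ => u; first by move/E1 => /= ->.
  by rewrite /= opprD addrACA subrr addr0.
have dv := deg_remove yA; move/(_ v): dv; rewrite e_sym yv -/A' => /(_ isT) dv.
have c0 : 0 <= c v by apply: le_trans (ck v); apply: expR_ge0.
apply: le_trans (flip_response_contract (g := g') (g' := g' \+ delta) vA' _ _) _.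
- by have := cg v vA; rewrite dv -natr1 E2; lra.
- by have := cgd v vA; rewrite /= dv -natr1 E2; lra.
apply: ler_wpM2l => //; apply: IH => //.
by move: cA; rewrite (cardsD1 y) yA.
Qed.

End Comparison.

End Ising.

(** * Expectation of the walk sum *)

(** Monotonicity without measurability of the smaller function: the integral of
    a nonnegative function is a supremum over the simple functions below it. *)
Lemma le_integral_nonmeasurable d (T : measurableType d) (R : realType)
    (mu : {measure set T -> \bar R}) (f g : T -> \bar R) :
  (forall t, 0 <= f t)%E -> (forall t, f t <= g t)%E ->
  (\int[mu]_t f t <= \int[mu]_t g t)%E.
Proof.
move=> f0 fg; have g0 t : (0 <= g t)%E by apply: le_trans (f0 t) (fg t).
rewrite !ge0_integralTE//; apply: ub_ereal_sup => _ [k kf <-].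
by apply: ereal_sup_ubound; exists k => // t; apply: le_trans (kf t) (fg t).
Qed.

Section Expectation.
Context {disp : measure_display} {T : measurableType disp} {R : realType}.
Variables (P : probability T R) (V : finType) (e : rel V).
Variables (bad : V -> set T) (a m : V -> R) (kappa b : R).
Hypothesis mbad : forall v, measurable (bad v).
Hypotheses (kappa0 : 0 <= kappa) (b0 : 0 <= b) (a0 : forall v, 0 <= a v).

Definition all_bad (S : {set V}) : set T :=
  [set t | forall v, v \in S -> bad v t]%classic.

Hypothesis P_all_bad : forall S, (P (all_bad S) <= (b ^+ #|S|)%:E)%E.

Definition cost (t : T) (v : V) : R := kappa + \1_(bad v) t.

Hypothesis m0 : forall v, 0 <= m v.
Hypothesis m_super : forall y, a y + \sum_(v | e y v) (kappa + b) * m v <= m y.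

Lemma cost_ge0 t v : 0 <= cost t v.
Proof. by rewrite addr_ge0// indicE. Qed.

Lemma measurable_all_bad S : measurable (all_bad S).
Proof.
have -> : all_bad S = (\bigcap_(v in [set v | v \in S]) bad v)%classic by [].
by apply: fin_bigcap_measurable => // ; exact: fin_finpred.
Qed.

Lemma measurable_saw_bound n A y :
  measurable_fun setT (fun t => saw_bound e a (cost t) n A y).
Proof.
elim: n A y => [|n IH] A y /=; first exact: measurable_cst.
apply: measurable_funD; first exact: measurable_cst.
under eq_fun do rewrite -big_filter.
apply: measurable_sum => v; apply: measurable_funM => //.
apply: measurable_funD; first exact: measurable_cst.
exact: measurable_indic.
Qed.

Lemma all_badU S v t :
  \1_(all_bad (v |: S)) t = \1_(all_bad S) t * \1_(bad v) t :> R.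
Proof.
have -> : all_bad (v |: S) = (all_bad S `&` bad v)%classic.
  apply/seteqP; split => s /=.
    by move=> H; split=> [u uS|]; apply: H; rewrite !inE ?uS ?eqxx ?orbT.
  by case=> H1 H2 u; rewrite !inE => /orP[/eqP -> //|/H1].
by rewrite indicI.
Qed.

(** Expanding the cost of [v] as [kappa] plus the indicator of [bad v], the
    second term adds [v] to the set [S] of vertices required to be bad.
    Carrying [S] through the induction reduces independence to the bound on
    [P (all_bad S)].  The set [S] avoids the vertices still to be visited, so
    that [v] is new. *)
Lemma integral_saw_bound n A y (S : {set V}) : [disjoint S & A :\ y] ->
  (\int[P]_t (\1_(all_bad S) t * saw_bound e a (cost t) n A y)%:E
   <= (b ^+ #|S| * m y)%:E)%E.
Proof.
elim: n A y S => [|n IH] A y S /= dis.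
  under eq_integral do rewrite mulr0.
  by rewrite integral0 lee_fin mulr_ge0// exprn_ge0.
pose X v t := saw_bound e a (cost t) n (A :\ y) v.
have X0 v t : 0 <= X v t by apply: saw_bound_ge0 => // u; apply: cost_ge0.
have i0 (E : set T) t : 0 <= \1_E t :> R by rewrite indicE.
have mi S' : measurable_fun setT (fun t => (\1_(all_bad S') t : R)).
  exact/measurable_indic/measurable_all_bad.
have mX v S' : measurable_fun setT (fun t => (\1_(all_bad S') t * X v t)%:E).
  by apply/measurable_EFinP/measurable_funM => //; exact: measurable_saw_bound.
pose F v t : \bar R := (kappa%:E * (\1_(all_bad S) t * X v t)%:E
                        + (\1_(all_bad (v |: S)) t * X v t)%:E)%E.
have E t : (\1_(all_bad S) t *
    (a y + \sum_(v in A :\ y | e y v) cost t v * X v t))%:E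
   = ((a y)%:E * (\1_(all_bad S) t)%:E
     + \sum_(v <- [seq v <- index_enum V | (v \in A :\ y) && e y v]) F v t)%E.
  rewrite big_filter mulrDr EFinD mulrC EFinM mulr_sumr -sumEFin; congr (_ + _)%E.
  apply: eq_bigr => v _; rewrite /F all_badU -EFinM -EFinD; congr EFin.
  by rewrite /cost; ring.
under eq_integral do rewrite E.
have F0 v t : (0 <= F v t)%E by rewrite adde_ge0// ?mule_ge0// lee_fin ?mulr_ge0.
have mF v : measurable_fun setT (F v).
  by apply: emeasurable_funD => //; apply: measurable_funeM.
rewrite ge0_integralD//; first last.
- exact: emeasurable_sum.
- by move=> t _; apply: sume_ge0.
- exact/measurable_funeM/measurable_EFinP/mi.
- by move=> t _; rewrite mule_ge0// lee_fin.
rewrite ge0_integralZl_EFin//; last exact/measurable_EFinP/mi.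
rewrite integral_indic//; last exact: measurable_all_bad.
rewrite setIT ge0_integral_sum// big_filter.
apply: (@le_trans _ _ ((a y)%:E * (b ^+ #|S|)%:E
   + \sum_(v in A :\ y | e y v) (b ^+ #|S| * ((kappa + b) * m v))%:E)%E).
  apply: leeD; first by apply: lee_wpmul2l; [rewrite lee_fin|exact: P_all_bad].
  apply: lee_sum => v /andP[vA yv].
  rewrite ge0_integralD//; first last.
  - by move=> t _; rewrite lee_fin mulr_ge0.
  - by apply: measurable_funeM.
  - by move=> t _; rewrite mule_ge0// lee_fin// mulr_ge0.
  rewrite ge0_integralZl_EFin//; last by move=> t _; rewrite lee_fin mulr_ge0.
  have vS : v \notin S by apply: contraL vA => /(disjointFr dis) ->.
  have d1 : [disjoint S & (A :\ y) :\ v].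
    by apply: disjointWr dis; exact: subD1set.
  have d2 : [disjoint v |: S & (A :\ y) :\ v].
    rewrite -finset.setI_eq0 finset.setIUl finset.setU_eq0 !finset.setI_eq0.
    rewrite d1 andbT disjoints1.
    by rewrite !inE eqxx.
  have := IH _ _ _ d2; rewrite cardsU1 vS add1n => H2.
  have H1 := IH _ _ _ d1.
  apply: (@le_trans _ _ (kappa%:E * (b ^+ #|S| * m v)%:E
                         + (b ^+ #|S|.+1 * m v)%:E)%E).
    by apply: leeD => //; apply: lee_wpmul2l.
  rewrite -EFinM -EFinD lee_fin exprS le_eqVlt; apply/orP; left.
  by apply/eqP; ring.
rewrite sumEFin -EFinM -EFinD lee_fin -mulr_sumr mulrC -mulrDr.
rewrite ler_wpM2l ?exprn_ge0//.
apply: le_trans (m_super y); rewrite lerD2l.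
rewrite [leLHS]big_mkcondl/=; apply: ler_sum => v _; case: ifP => // _.
by rewrite mulr_ge0// addr_ge0.
Qed.

End Expectation.

(** * The lattice *)

Section LatticeFacts.
Variable d : nat.
Implicit Types u v z : lattice d.

Lemma adjP u v : reflect
  (exists i, v = u + delta_mx 0 i \/ v = u - delta_mx 0 i) (adj u v).
Proof.
apply: (iffP idP) => [|[i uv]]; rewrite /adj /nbrs in_fsetU.
  by case/orP=> /imfsetP[i _ ->]; exists i; [left|right].
by apply/orP; case: uv => ->; [left|right]; apply/imfsetP; exists i.
Qed.

Lemma adj_sym : symmetric (@adj d).
Proof.
suff H u v : adj u v -> adj v u by move=> u v; apply/idP/idP; exact: H.
case/adjP=> i [->|->]; apply/adjP; exists i; [right|left].
  by rewrite addrK.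
by rewrite subrK.
Qed.

Lemma adj_irr : irreflexive (@adj d).
Proof.
move=> u; apply/adjP => -[i] [] /eqP; rewrite eq_sym -subr_eq0.
  rewrite addrAC subrr add0r => /eqP/rowP/(_ i).
  by rewrite !mxE !eqxx.
rewrite addrAC subrr add0r => /eqP/rowP/(_ i).
by rewrite !mxE !eqxx.
Qed.

Lemma card_nbrs u : (#|` nbrs u| <= 2 * d)%N.
Proof.
rewrite mul2n -addnn; apply: leq_trans (leq_card_fsetU _ _) _.
by apply: leq_add; apply: leq_trans (leq_imfset_card _ _ _) _;
  rewrite ?card_ord// -cardE card_ord.
Qed.

Lemma dist_adj u v z : adj u v -> (dist u z <= (dist v z).+1)%N.
Proof.
move=> uv; apply/bigmax_leqP => i _.
have : (absz (v 0 i - z 0 i)%R <= dist v z)%N.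
  by rewrite /dist (bigD1 i)//= leq_maxl.
case/adjP: uv => j [] ->; rewrite !mxE/=; move: (u 0 i) (z 0 i) (dist _ _).
  by case: (i == j) => /= x y n; lia.
by case: (i == j) => /= x y n; lia.
Qed.

Lemma dist_refl z : dist z z = 0%N.
Proof.
by apply/eqP; rewrite -leqn0; apply/bigmax_leqP => i _; rewrite subrr.
Qed.

End LatticeFacts.

(** * Influence of a boundary spin *)

Section GibbsLogodds.
Variables (R : realType) (d : nat) (beta : R).
Hypothesis beta0 : 0 <= beta.
Variables (B : {fset lattice d}).
Implicit Types (h : lattice d -> R) (xi : {ffun bdry B -> bool}).

Definition site_adj : rel B := fun u v => adj (val u) (val v).

Lemma site_adj_sym : symmetric site_adj.
Proof. by move=> u v; exact: adj_sym. Qed.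

Lemma site_adj_irr : irreflexive site_adj.
Proof. by move=> u; exact: adj_irr. Qed.

Definition field h xi (u : B) : R :=
  h (val u) + beta * \sum_(v : bdry B | adj (val u) (val v)) spin R (xi v).

Lemma weightE h xi sigma :
  weight beta h xi sigma =
  expR (energy site_adj beta [set: B] (field h xi) sigma).
Proof.
rewrite /weight /energy; congr expR; rewrite -addrA; congr (_ + _).
  congr (beta * (2^-1 * _)); apply: eq_big => [u|u _]; first by rewrite inE.
  by apply: eq_bigl => v; rewrite inE.
rewrite mulr_sumr -big_split; apply: eq_big => [u|u _]; first by rewrite inE.
rewrite /field mulrDl addrC /=; congr (_ + _).
by rewrite -mulrA mulr_suml; congr (_ * _); apply: eq_bigr => v _; rewrite mulrC.
Qed.

Lemma spin_lawE h xi x s : spin_law beta h xi x s =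
  pinned_partition site_adj beta [set: B] (field h xi) x s /
    (pinned_partition site_adj beta [set: B] (field h xi) x true
     + pinned_partition site_adj beta [set: B] (field h xi) x false).
Proof.
rewrite /spin_law -partition_fun_split /gibbs -mulr_suml; congr (_ / _).
  by apply: eq_bigr => sigma _; rewrite weightE.
by apply: eq_bigr => sigma _; rewrite weightE.
Qed.

(** A probability is a 1-Lipschitz function of its log-odds. *)
Lemma frac_le_logodds (p q p' q' : R) : 0 < p -> 0 < q -> 0 < p' -> 0 < q' ->
  `|p / (p + q) - p' / (p' + q')| <= `|(ln p - ln q) - (ln p' - ln q')|.
Proof.
wlog : p q p' q' / p' / (p' + q') <= p / (p + q).
  move=> W *; case: (leP (p' / (p' + q')) (p / (p + q))) => [|/ltW] ?.
    exact: W.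
  by rewrite distrC [leRHS]distrC; apply: W.
move=> le p0 q0 p'0 q'0; rewrite ger0_norm ?subr_ge0//.
apply: le_trans (ler_norm _).
have s0 : 0 < p + q by lra.
have s'0 : 0 < p' + q' by lra.
have pq : p' * q <= p * q'.
  move: le; rewrite ler_pdivrMr// mulrAC ler_pdivlMr//; lra.
have -> : ln p - ln q - (ln p' - ln q') = ln (p * q') - ln (p' * q).
  by rewrite !lnM ?posrE//; ring.
set x := _ - ln _.
have E : p' * q = expR (- x) * (p * q').
  rewrite /x opprB expRD expRN !lnK ?posrE ?mulr_gt0//.
  by rewrite -mulrA mulVf ?mulr1// gt_eqF ?mulr_gt0.
have ex : 1 + - x <= expR (- x) by exact: expR_ge1Dx.
have x0 : 0 <= x by rewrite subr_ge0 ler_ln ?posrE ?mulr_gt0.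
have -> : p / (p + q) - p' / (p' + q') = (p * q' - p' * q) / ((p + q) * (p' + q')).
  by field; rewrite !gt_eqF.
rewrite ler_pdivrMr ?mulr_gt0// E.
have w0 : 0 < p * q' by rewrite mulr_gt0.
apply: (@le_trans _ _ (x * (p * q'))); first nra.
by apply: ler_wpM2l => //; nra.
Qed.

Lemma dTV_spin_law h xi xi' x :
  dTV (spin_law beta h xi x) (spin_law beta h xi' x) <=
  2 * `|logodds site_adj beta [set: B] (field h xi) x
        - logodds site_adj beta [set: B] (field h xi') x|.
Proof.
set L : R := `| _ |.
have E s : `|spin_law beta h xi x s - spin_law beta h xi' x s| <= L.
  rewrite !spin_lawE /L /logodds.
  set p := pinned_partition _ _ _ (field h xi) _ true.
  set q := pinned_partition _ _ _ (field h xi) _ false.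
  set p' := pinned_partition _ _ _ (field h xi') _ true.
  set q' := pinned_partition _ _ _ (field h xi') _ false.
  have p0 : 0 < p := pinned_partition_gt0 _ _ _ _ _ _.
  have q0 : 0 < q := pinned_partition_gt0 _ _ _ _ _ _.
  have p'0 : 0 < p' := pinned_partition_gt0 _ _ _ _ _ _.
  have q'0 : 0 < q' := pinned_partition_gt0 _ _ _ _ _ _.
  case: s; first exact: frac_le_logodds.
  have := frac_le_logodds q0 p0 q'0 p'0; rewrite -/q -/q' (addrC q) (addrC q').
  by rewrite -[leRHS]normrN; congr (_ <= `|_|); ring.
apply: bigmax_le => [|S _]; first by rewrite mulr_ge0 ?normr_ge0.
rewrite -sumrB; apply: (le_trans (ler_norm_sum _ _ _)).
apply: (@le_trans _ _ (\sum_(s : bool)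
    `|spin_law beta h xi x s - spin_law beta h xi' x s|)).
  by rewrite big_mkcond/=; apply: ler_sum => s _; case: ifP.
by rewrite big_bool/=; have := E true; have := E false; lra.
Qed.

Lemma card_site_nbrs (u : B) :
  (#|[set v : B | adj (val u) (val v)]|
   + #|[set v : bdry B | adj (val u) (val v)]|
   <= 2 * d)%N.
Proof.
apply: leq_trans (card_nbrs (val u)).
pose s1 := [seq val v | v <- enum [set v : B | adj (val u) (val v)]].
pose s2 := [seq val v | v <- enum [set v : bdry B | adj (val u) (val v)]].
have -> : (#|[set v : B | adj (val u) (val v)]|
   + #|[set v : bdry B | adj (val u) (val v)]| = size (s1 ++ s2))%N.
  by rewrite size_cat !size_map -!cardE.
apply: uniq_leq_size.
  rewrite cat_uniq !map_inj_uniq ?enum_uniq; try exact: val_inj.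
  rewrite /= andbT; apply/hasPn => _ /mapP[v _ ->]; apply/mapP => -[w _ vw].
  by have := fsvalP v; rewrite vw in_fsetD (fsvalP w).
by move=> y; rewrite mem_cat => /orP[] /mapP[v]; rewrite mem_enum inE => uv ->.
Qed.

Lemma deg_le (u : B) : (deg site_adj [set: B] u <= 2 * d)%N.
Proof.
apply: leq_trans (card_site_nbrs u); apply: leq_trans (leq_addr _ _).
by apply: subset_leq_card; apply/fintype.subsetP => v; rewrite !inE.
Qed.

Lemma boundary_room_field h xi :
  boundary_room site_adj beta (fun u : B => h (val u)) (2 * d%:R * beta)
    [set: B] (field h xi).
Proof.
move=> u _; rewrite /field addrAC subrr add0r normrM (ger0_norm beta0) -mulrDr.
rewrite mulrC; apply: ler_wpM2r => //.
have H : `|\sum_(v : bdry B | adj (val u) (val v)) spin R (xi v)|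
   <= #|[set v : bdry B | adj (val u) (val v)]|%:R.
  apply: (le_trans (ler_norm_sum _ _ _)).
  rewrite -sum1_card natr_sum; under [leRHS]eq_bigl do rewrite inE.
  by apply: ler_sum => v _; rewrite /spin; case: (xi v); rewrite ?normrN normr1.
apply: (le_trans (lerD H (lexx _))).
rewrite -natrD -natrM ler_nat addnC; apply: leq_trans (card_site_nbrs u).
rewrite leq_add2r; apply: subset_leq_card; apply/fintype.subsetP => v.
by rewrite !inE.
Qed.

(** Twice the change of field, since a field enters the log-odds doubled. *)
Definition source z (u : B) : R := 4 * beta * (adj (val u) z)%:R.

(** The site [z] occurs once in the boundary, and flipping its spin from [-1] to
    [1] adds [2 * beta] to the field at each neighbour. *)
Lemma field_extend h z (xi : {ffun (bdry B `\ z)%fset -> bool}) :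
  z \in bdry B ->
  field h (extend xi true) =
  field h (extend xi false) \+ (fun u => 2 * beta * (adj (val u) z)%:R).
Proof.
move=> zB; apply/funext => u; rewrite /field/= -addrA; congr (_ + _).
have -> : 2 * beta * (adj (val u) z)%:R = beta * (2 * (adj (val u) z)%:R).
  by ring.
rewrite -mulrDr; congr (_ * _); apply/eqP; rewrite addrC -subr_eq -sumrB; apply/eqP.
pose zz : bdry B := [` zB]%fset.
have E (v : bdry B) : spin R (extend xi true v) - spin R (extend xi false v)
    = if v == zz then 2 else 0.
  rewrite !ffunE; case: eqP => [->|nv].
    rewrite insubF ?in_fsetD1 ?eqxx// /spin; lra.
  rewrite insubT ?in_fsetD1 ?fsvalP ?andbT => [|?]; last by rewrite subrr.
  by apply/eqP => vz; apply: nv; apply: val_inj.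
under eq_bigr do rewrite E.
rewrite -big_mkcondr/=; case: (boolP (adj (val u) z)) => uz.
  rewrite (big_pred1 zz) ?mulr1// => v; rewrite /= andbC.
  by case: eqP => //= ->.
rewrite big_pred0 ?mulr0// => v; apply/negbTE; apply: contra uz.
by case/andP=> uv /eqP vz; rewrite vz in uv.
Qed.

Lemma influence_le h (K : R) (c : B -> R) (x : B) z : z \in bdry B ->
  (forall u : B, `|h (val u)| <= K -> 1 <= c u) ->
  (forall u, expR (2 * (2 * d%:R * beta) - 2 * K) <= c u) ->
  influence beta h x z <=
  2 * saw_bound site_adj (source z) c #|{: B}| [set: B] x.
Proof.
move=> zB c1 ck; apply: bigmax_le => [|xi _].
  rewrite mulr_ge0// saw_bound_ge0// => [u|u].
    by rewrite /source !mulr_ge0.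
  by apply: le_trans (ck u); apply: expR_ge0.
apply: (le_trans (dTV_spin_law _ _ _ _)); apply: ler_wpM2l => //.
rewrite field_extend//; apply: logodds_diff.
- exact: site_adj_sym.
- exact: site_adj_irr.
- exact: beta0.
- by move=> u; rewrite /source ger0_norm ?mulr_ge0//; lra.
- exact: c1.
- exact: ck.
- by rewrite cardsT.
- by rewrite inE.
- exact: boundary_room_field.
- by rewrite -field_extend//; exact: boundary_room_field.
Qed.

End GibbsLogodds.

(** * Exponential decay *)

Lemma prob_all_le (R : realType) (disp : measure_display)
    (T : measurableType disp) (P : probability T R) (I : choiceType)
    (B : {fset I}) (X : I -> T -> R) (K b : R) :
  mutually_independent P X ->
  (forall i, measurable [set t | (X i t <= K)%R]%classic) ->
  (forall i, (P [set t | (X i t <= K)%R]%classic <= b%:E)%E) ->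
  forall S : {set B},
  (P (all_bad (fun v : B => [set t | (X (val v) t <= K)%R]%classic) S)
   <= (b ^+ #|S|)%:E)%E.
Proof.
move=> ind mX Pb S; pose J : {fset I} := [fset val v | v in S]%fset.
have -> : all_bad (fun v : B => [set t | (X (val v) t <= K)%R]%classic) S =
    [set t | forall i, i \in J -> [set y : R | y <= K]%classic (X i t)]%classic.
  apply/seteqP; split=> t /= H.
    by move=> i /imfsetP[v /= vS ->]; exact: H.
  by move=> v vS; apply: H; apply/imfsetP; exists v.
rewrite (ind J (fun=> [set y : R | y <= K]%classic)); last first.
  move=> _; rewrite (_ : [set y | y <= K]%classic = `]-oo, K]%classic).
    exact: measurable_itv.
  by apply/seteqP; split=> y /=; rewrite in_itv.
have cJ : #|` J| = #|S| by rewrite card_imfset /= -?cardE//; exact: val_inj.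
have -> : b ^+ #|S| = \prod_(i <- J) b.
  by rewrite big_const_seq count_predT iter_mulr_1 -cJ.
rewrite lee_fin.
apply: ler_prod => i _; rewrite fine_ge0 ?measure_ge0//=.
have := Pb i.
by rewrite -[X in (X <= _)%E -> _]fineK ?lee_fin// fin_num_measure//; exact: mX.
Qed.

(** With [x = expR (D - K)] the left-hand side of the hypothesis is
    [x ^+ 2 / (x ^+ 2 + 1)], and the claim is about [x ^+ 2]. *)
Lemma kappa_lt (R : realType) (D K r : R) : r <= 2^-1 ->
  expR (D - K) / (expR (D - K) + expR (- D + K)) < r ->
  expR (2 * D - 2 * K) < 2 * r.
Proof.
move=> r2; have x0 := expR_gt0 (D - K).
have -> : expR (- D + K) = (expR (D - K))^-1.
  by rewrite -expRN; congr expR; ring.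
have -> : expR (2 * D - 2 * K) = expR (D - K) * expR (D - K).
  by rewrite -expRD; congr expR; ring.
set x := expR _ in x0 *.
have xx : 0 < x * x by rewrite mulr_gt0.
have -> : x / (x + x^-1) = (x * x) / (x * x + 1).
  by field; rewrite !gt_eqF//; lra.
rewrite ltr_pdivrMr; last lra.
nra.
Qed.

(** The constant [C = M + 2] serves both as prefactor and as decay length,
    because [expR (- C^-1) >= 1 - C^-1 >= 2^-1]. *)
Lemma geometric_le_expR (R : realType) (M : R) (n : nat) : 0 <= M ->
  M * 2^-1 ^+ n <= (M + 2) * expR (- n%:R / (M + 2)).
Proof.
move=> M0; have M2 : 0 < M + 2 by lra.
have -> : - n%:R / (M + 2) = - (M + 2)^-1 * n%:R.
  by field; rewrite gt_eqF.
rewrite expRM_natr; apply: ler_pM => //; first lra.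
apply: lerXn2r; rewrite ?nnegrE ?expR_ge0//.
apply: le_trans (expR_ge1Dx _).
have : (M + 2)^-1 <= 2^-1 by rewrite lef_pV2 ?posrE//; lra.
lra.
Qed.

Theorem lemma5p19 (R : realType) (disp : measure_display)
    (T : measurableType disp) (P : probability T R)
    (d : nat) (beta : R) (h : lattice d -> {RV P >-> R}) (K : R) :
  (2 <= d)%N -> 0 < beta ->
  iid P (fun (x : lattice d) (t : T) => `|h x t|) ->
  (forall x : lattice d,
     (P [set t | (`|h x t| <= K)%R]%classic < ((40 * d%:R)^-1)%R%:E)%E) ->
  rho d beta K < (40 * d%:R)^-1 ->
  exists2 C : R, 0 < C & SSM P beta (fun (x : lattice d) (t : T) => h x t) C.
Proof.
move=> d2 beta0 [ind _] Pbad rhoK.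
have beta0' := ltW beta0.
have dR : 2 <= d%:R :> R by rewrite (ler_nat R 2).
set b : R := (40 * d%:R)^-1 in Pbad rhoK.
have db : d%:R * b = 40^-1 by rewrite /b; field; rewrite gt_eqF//; lra.
have b0 : 0 < b by rewrite invr_gt0; lra.
have b2 : b <= 2^-1 by rewrite lef_pV2 ?posrE; lra.
set kappa : R := expR (2 * (2 * d%:R * beta) - 2 * K).
have kb : kappa < 2 * b by apply: kappa_lt.
have k0 : 0 <= kappa by exact: expR_ge0.
(* The influence is at most 2 * F with F of mean at most m o, where m is
   12 * beta at distance 0; hence 24 * beta. *)
exists (24 * beta + 2); first lra.
move=> r w hw z r1 zB; set B := box w r in zB *.
set o : B := [` _ ]%fset.
pose bad (v : B) : set T := [set t | (`|h (val v) t| <= K)%R]%classic.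
have mbad x : measurable [set t | (`|h x t| <= K)%R]%classic.
  have -> : [set t | (`|h x t| <= K)%R]%classic
          = ((fun t => `|h x t|) @^-1` `]-oo, K])%classic.
    by apply/seteqP; split=> t /=; rewrite in_itv.
  rewrite -[X in measurable X]setTI.
  apply: (measurableT_comp (@normr_measurable R setT)) => //.
pose m (v : B) : R := 12 * beta * 2^-1 ^+ dist (val v) z.
have m0 v : 0 <= m v by rewrite mulr_ge0 ?exprn_ge0//; lra.
have a0 (v : B) : 0 <= source beta z v :> R by rewrite /source mulr_ge0//; lra.
have half n : 0 <= 2^-1 ^+ n :> R by rewrite exprn_ge0.
(* A neighbour multiplies m by at most 2, so the sum is at most
   2 * d * (3 * b) * 2 = 3 / 10 times m y, while the source, at distance at most
   1 from z, is at most 8 * beta * 2^-1 ^+ dist y z = 2 / 3 times m y. *)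
have m_super y : source beta z y
    + \sum_(v | site_adj y v) (kappa + b) * m v <= m y.
  have Hs : source beta z y <= 8 * beta * 2^-1 ^+ dist (val y) z.
    rewrite /source; case: (boolP (adj _ _)) => yz; last first.
      by rewrite mulr0 mulr_ge0//; lra.
    have := dist_adj z yz; rewrite dist_refl.
    case: (dist _ _) => [|[|//]] _; rewrite ?expr0 ?expr1 ?mulr1; lra.
  have Hm : \sum_(v | site_adj y v) (kappa + b) * m v <=
      \sum_(v | site_adj y v) (3 * b) * (2 * m y).
    apply: ler_sum => v yv; apply: ler_pM => //; first lra.
      lra.
    rewrite /m mulrCA; apply: ler_wpM2l; first lra.
    have : 2^-1 ^+ (dist (val v) z).+1 <= 2^-1 ^+ dist (val y) z :> R.
      by apply: ler_wiXn2l; [lra|lra|exact: dist_adj].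
    by rewrite exprS; lra.
  have Hd : \sum_(v | site_adj y v) (3 * b) * (2 * m y) <=
       (2 * d%:R) * ((3 * b) * (2 * m y)).
    rewrite sumr_const -[leLHS]mulr_natl; apply: ler_wpM2r.
      by rewrite !mulr_ge0//; lra.
    rewrite -natrM ler_nat; apply: leq_trans (deg_le y).
    rewrite /deg; apply: subset_leq_card; apply/fintype.subsetP => v.
    by rewrite !inE.
  have E : (2 * d%:R) * ((3 * b) * (2 * m y)) = 12 * 40^-1 * m y.
    by rewrite -db; ring.
  have := m0 y; move: (half (dist (val y) z)) Hs Hm Hd E; rewrite /m.
  set q := 2^-1 ^+ _; move=> q0 *.
  have : 0 <= beta * q by rewrite mulr_ge0.
  lra.
have Pall (S : {set B}) : (P (all_bad bad S) <= (b ^+ #|S|)%:E)%E.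
  apply: (@prob_all_le _ _ _ _ _ B (fun x t => `|h x t|)) => // x.
  exact/ltW/Pbad.
(* The empty set of bad vertices gives the plain expectation. *)
have main := @integral_saw_bound _ _ _ P _ (@site_adj d B) bad (source beta z) m
  kappa b (fun v => mbad (val v)) k0 (ltW b0) a0 Pall m0 m_super
  #|{: B}| [set: B] o finset.set0.
rewrite unlock.
set F := fun t => saw_bound (@site_adj d B) (source beta z) (cost bad kappa t)
            #|{: B}| [set: B] o.
have F0 t : 0 <= F t by apply: saw_bound_ge0 => // v; exact: cost_ge0.
have mF : measurable_fun setT F.
  by apply: measurable_saw_bound => v; exact: mbad.
(* F depends on t only through the bad events, hence is measurable. *)
apply: (@le_trans _ _ (\int[P]_t (2%:E * (F t)%:E))%E).
  apply: le_integral_nonmeasurable => t.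
    by rewrite lee_fin; exact: bigmax_ge_id.
  rewrite -EFinM lee_fin; apply: (@influence_le _ _ _ _ _ _ K) => // u.
    move=> hu; rewrite /cost indicE mem_set//=; lra.
  by rewrite /cost lerDl indicE.
rewrite ge0_integralZl_EFin//;
  [|by move=> t _; rewrite lee_fin|exact/measurable_EFinP].
apply: (@le_trans _ _ (2%:E * (m o)%:E)%E).
  apply: lee_wpmul2l => //.
  have : [disjoint (finset.set0 : {set B}) & [set: B] :\ o].
    by rewrite -finset.setI_eq0 finset.set0I eqxx.
  move/main; rewrite cards0 expr0 mul1r; apply: le_trans.
  apply: le_integral_nonmeasurable => t; rewrite lee_fin//.
  rewrite indicE mem_set ?mul1r// => v; by rewrite inE.
rewrite -EFinM lee_fin /m.
have M0 : 0 <= 24 * beta by lra.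
apply: le_trans (geometric_le_expR _ M0).
by rewrite /o /=; lra.
Qed.
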